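(* Let $n,k$ be integers with $1\le k\le n-1$ and let $r_1\ge\cdots\ge r_n\ge 0$. Consider the booby trap search game with $n$ boxes, rewards $r_1,\dots,r_n$ and $k$ booby traps played on an arbitrary hypergraph $G$ with vertex set $[n]$. Let $\mathcal S=\{S_1,\dots,S_t\}$, $t\ge1$, be a set of (distinct) hyperedges of $G$ with $r(S_j)>0$ for every $j$. Consider the Searcher mixed strategy $p$ that chooses $S_j$ with probability $p(S_j)=\lambda/r(S_j)$, $j=1,\dots,t$, where $$\lambda=\lambda(\mathcal S)=\frac{1}{\sum_{j=1}^t 1/r(S_j)}.$$ This strategy guarantees the Searcher an expected payoff of at least $m\lambda$ (that is, $R(p,H)\ge m\lambda$ for every $H\in[n]^{(k)}$), where $$m=m(\mathcal S)=\min_{H\in[n]^{(k)}}\big|\{S_j\in\mathcal S: S_j\cap H=\emptyset\}\big| .$$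
   Context: The booby trap search game: there are $n$ boxes, identified with the vertex set $[n]=\{1,\dots,n\}$ of a hypergraph $G$ with set of hyperedges $E\subseteq 2^{[n]}$. Box $i$ contains a reward $r_i$. A Hider pure strategy is a set $H\in[n]^{(k)}=\{H\subseteq[n]:|H|=k\}$ (the booby trapped boxes). A Searcher pure strategy is a hyperedge $S\in E$ (the boxes opened). For $S\subseteq[n]$ write $r(S)=\sum_{i\in S}r_i$. The payoff (to the maximizing Searcher, in a zero-sum game against the minimizing Hider) is $R(S,H)=r(S)$ if $S\cap H=\emptyset$, and $R(S,H)=0$ otherwise. Mixed strategies are probability distributions over pure strategies; $R(p,H)$ denotes the expected payoff of a Searcher mixed strategy $p$ against $H$. *)

(* Defs.v *)
From mathcomp Require Import all_boot all_order all_algebra.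

Set Implicit Arguments.
Unset Strict Implicit.
Unset Printing Implicit Defensive.

Import Order.TTheory GRing.Theory Num.Theory.
Local Open Scope ring_scope.

(** The boxes are the elements of ['I_n], so that the box numbered [i.+1] in
    the one-based numbering is [i : 'I_n]; a hypergraph on the boxes is given by
    its set of hyperedges [E : {set {set 'I_n}}]. *)

Definition reward (R : realFieldType) (n : nat) (r : 'I_n -> R)
    (S : {set 'I_n}) : R :=
  \sum_(i in S) r i.

Definition hider_strategies (n k : nat) : {set {set 'I_n}} :=
  [set H : {set 'I_n} | #|H| == k].

Definition payoff (R : realFieldType) (n : nat) (r : 'I_n -> R)
    (S H : {set 'I_n}) : R :=
  if S :&: H == set0 then reward r S else 0.

Definition searcher_mixed_strategy (R : realFieldType) (n : nat)
    (E : {set {set 'I_n}}) (p : {set 'I_n} -> R) : Prop :=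
  [/\ forall S, S \in E -> 0 <= p S,
      forall S, S \notin E -> p S = 0
    & \sum_(S in E) p S = 1].

Definition expected_payoff (R : realFieldType) (n : nat)
    (E : {set {set 'I_n}}) (r : 'I_n -> R) (p : {set 'I_n} -> R)
    (H : {set 'I_n}) : R :=
  \sum_(S in E) p S * payoff r S H.

Definition lambda (R : realFieldType) (n : nat) (r : 'I_n -> R)
    (SS : {set {set 'I_n}}) : R :=
  (\sum_(S in SS) (reward r S)^-1)^-1.

Definition lambda_strategy (R : realFieldType) (n : nat) (r : 'I_n -> R)
    (SS : {set {set 'I_n}}) (S : {set 'I_n}) : R :=
  if S \in SS then lambda r SS / reward r S else 0.

Definition num_avoiding (n : nat) (SS : {set {set 'I_n}}) (H : {set 'I_n}) :
    nat :=
  #|[set S in SS | S :&: H == set0]|.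

(** The initial value [#|SS|] bounds every term from above, so it does not
    affect the minimum when there is a Hider strategy, i.e. when [k <= n];
    see [min_avoiding_le] and [min_avoiding_attained]. *)
Definition min_avoiding (n k : nat) (SS : {set {set 'I_n}}) : nat :=
  \big[minn/#|SS|]_(H in hider_strategies n k) num_avoiding SS H.

Lemma min_avoiding_le (n k : nat) (SS : {set {set 'I_n}}) (H : {set 'I_n}) :
  H \in hider_strategies n k -> (min_avoiding k SS <= num_avoiding SS H)%N.
Proof.
move=> Hin; have := mem_index_enum H; rewrite /min_avoiding.
elim: (index_enum _) => //= H' s IH.
rewrite inE big_cons => /predU1P[<- | /IH le_m]; first by rewrite Hin geq_minl.
by case: ifP => // _; rewrite geq_min le_m orbT.
Qed.

Lemma min_avoiding_attained (n k : nat) (SS : {set {set 'I_n}}) :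
  (k <= n)%N ->
  exists2 H, H \in hider_strategies n k & min_avoiding k SS = num_avoiding SS H.
Proof.
move=> le_kn.
have [H0 H0in] : exists H0, H0 \in hider_strategies n k.
  apply/set0Pn; rewrite -card_gt0.
  suff -> : #|hider_strategies n k| = 'C(n, k) by rewrite bin_gt0.
  by rewrite -[n in RHS]card_ord -card_draws.
have le_card H : (num_avoiding SS H <= #|SS|)%N.
  by apply/subset_leq_card/subsetP => S; rewrite inE => /andP[].
suff [eq_m | [H Hin eq_m]] : min_avoiding k SS = #|SS| \/
    exists2 H, H \in hider_strategies n k & min_avoiding k SS = num_avoiding SS H.
- exists H0 => //; apply/eqP; rewrite eqn_leq min_avoiding_le //=.
  by rewrite eq_m le_card.
- by exists H.
rewrite /min_avoiding; elim/big_rec: _ => [|H m Hin IH]; first by left.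
by rewrite /minn; case: ifP => _; [right; exists H | exact: IH].
Qed.

(* Main.v *)
(** Against [H], each [S] of [SS] avoiding [H] contributes
    [lambda / r(S) * r(S) = lambda] to the expected payoff and every other
    hyperedge contributes [0], so the expected payoff is exactly [lambda] times
    the number of sets of [SS] avoiding [H]. *)

Require Import Defs.
From mathcomp Require Import all_boot all_order all_algebra.

Import Order.TTheory GRing.Theory Num.Theory.
Local Open Scope ring_scope.

(** The strategy vanishes on [E :\: SS]. The weight [f] is left arbitrary to serve both the total
    probability ([f] constantly 1) and the expected payoff. *)
Lemma sum_lambda_strategy (R : realFieldType) (n : nat) (r : 'I_n -> R)
    (E SS : {set {set 'I_n}}) (f : {set 'I_n} -> R) :
  SS \subset E ->
  \sum_(S in E) lambda_strategy r SS S * f S =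
  \sum_(S in SS) lambda r SS / reward r S * f S.
Proof.
move=> sSE; rewrite (big_setID SS) /= (setIidPr sSE) [X in _ + X]big1 ?addr0.
  by apply: eq_bigr => S SinSS; rewrite /lambda_strategy SinSS.
by move=> S /setDP[_ /negPf SninSS]; rewrite /lambda_strategy SninSS mul0r.
Qed.

(** A member of [SS] gives the sum of inverses a positive term; for empty [SS], [lambda] would be
    [0^-1 = 0]. *)
Lemma lambda_gt0 (R : realFieldType) (n : nat) (r : 'I_n -> R)
    (SS : {set {set 'I_n}}) :
  (0 < #|SS|)%N -> (forall S, S \in SS -> 0 < reward r S) -> 0 < lambda r SS.
Proof.
move=> /card_gt0P[S0 S0in] pos.
rewrite /lambda invr_gt0 (bigD1 S0) //= ltr_pwDl ?invr_gt0 ?pos //.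
by apply: sumr_ge0 => S /andP[Sin _]; rewrite invr_ge0 ltW ?pos.
Qed.

Lemma lambda_strategy_mixed (R : realFieldType) (n : nat) (r : 'I_n -> R)
    (E SS : {set {set 'I_n}}) :
  SS \subset E -> (0 < #|SS|)%N -> (forall S, S \in SS -> 0 < reward r S) ->
  searcher_mixed_strategy E (lambda_strategy r SS).
Proof.
move=> sSE SSn0 pos; have lam_gt0 : 0 < lambda r SS by exact: lambda_gt0.
split=> [S _|S SninE|].
- rewrite /lambda_strategy; case: ifP => // Sin.
  by rewrite divr_ge0 ?ltW ?pos.
- rewrite /lambda_strategy ifN //.
  by apply: contra SninE; apply: (subsetP sSE).
- under eq_bigr do rewrite -[lambda_strategy _ _ _]mulr1.
  rewrite sum_lambda_strategy //; under eq_bigr do rewrite mulr1.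
  (* The sum of inverses cancels against [lambda]; it is nonzero because its inverse [lambda] is
     positive. *)
  rewrite -mulr_sumr mulVf //.
  by rewrite -invr_eq0 gt_eqF.
Qed.

Lemma expected_payoff_lambda_strategy (R : realFieldType) (n : nat)
    (r : 'I_n -> R) (E SS : {set {set 'I_n}}) (H : {set 'I_n}) :
  SS \subset E -> (forall S, S \in SS -> 0 < reward r S) ->
  expected_payoff E r (lambda_strategy r SS) H =
  (num_avoiding SS H)%:R * lambda r SS.
Proof.
move=> sSE pos; rewrite /expected_payoff sum_lambda_strategy //.
(* The count times [lambda] becomes a sum over [SS] of [lambda] or 0, to be compared termwise with
   the payoffs. *)
rewrite /num_avoiding mulr_natl -sumr_const.
rewrite [RHS](eq_bigl _ _ (in_set _)) [RHS]big_mkcondr /=.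
apply: eq_bigr => S Sin; rewrite /payoff; case: ifP => _; last exact: mulr0.
by rewrite divfK // gt_eqF ?pos.
Qed.

Theorem proposition14 (R : realFieldType) (n k : nat)
    (hk1 : (1 <= k)%N) (hkn : (k <= n - 1)%N)
    (r : 'I_n -> R)
    (r_nonincr : forall i j : 'I_n, (i <= j)%N -> r j <= r i)
    (r_ge0 : forall i : 'I_n, 0 <= r i)
    (E SS : {set {set 'I_n}})
    (SS_edges : SS \subset E)
    (SS_nonempty : (1 <= #|SS|)%N)
    (SS_pos : forall S : {set 'I_n}, S \in SS -> 0 < reward r S) :
  searcher_mixed_strategy E (lambda_strategy r SS) /\
  forall H : {set 'I_n}, H \in hider_strategies n k ->
    (min_avoiding k SS)%:R * lambda r SS
      <= expected_payoff E r (lambda_strategy r SS) H.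
Proof.
split=> [|H Hin]; first exact: lambda_strategy_mixed.
rewrite expected_payoff_lambda_strategy //.
(* Scaling by [lambda >= 0] preserves the bound on the count. *)
by rewrite ler_wpM2r ?ler_nat ?min_avoiding_le ?ltW ?lambda_gt0.
Qed.
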